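(* Let $1\le n\le 4$. For every nonempty subset $S$ of the symmetric group of permutations of $\{0,\dots,n-1\}$, the polynomial \[P_S(\lambda)=\sum_{\sigma\in S}\operatorname{sgn}(\sigma)\prod_{i=0}^{n-1}(\lambda+i)^{\sigma(i)}\in\mathbb{Q}[\lambda]\] is not identically zero. *)

(* Defs.v *)
From mathcomp Require Import all_boot all_order all_algebra all_fingroup.

Set Implicit Arguments.
Unset Strict Implicit.
Unset Printing Implicit Defensive.

Import GRing.Theory.
Local Open Scope ring_scope.

(* [odd_perm s] coerces to nat, so [(-1) ^+ s] is the signature of [s]. *)
Definition PS (n : nat) (S : {set 'S_n}) : {poly rat} :=
  \sum_(s in S) (-1) ^+ s * \prod_(i < n) ('X + (i%:R)%:P) ^+ s i.

(* Main.v *)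
Require Import Defs.
From mathcomp Require Import all_boot all_order all_algebra all_fingroup.

(** Fix [n <= 4] and suppose [P_S = 0].  At [lambda = -i] a permutation
    contributes to [P_S] only if it sends [i] to [0], so the evaluations at
    [0, -1, ..., 1 - n] constrain disjoint blocks of permutations separately.
    Each block has few subsets with vanishing signed sum (for [n = 4] there are
    2, 5, 5 and 2 of them), and of the resulting candidates for [S] (100
    of them) only the empty one also vanishes at [lambda = 1] and at [lambda = -n].  Signs are
    read off the one-line notation through the Vandermonde product, which
    a permutation of the nodes multiplies by its signature. *)

Set Implicit Arguments.
Unset Strict Implicit.
Unset Printing Implicit Defensive.

Import Order.TTheory GRing.Theory Num.Theory.
Local Open Scope ring_scope.

Section OneLineNotation.

Variable n : nat.
Implicit Types s : 'S_n.

Definition oneline s : seq nat := [seq val (s i) | i <- enum 'I_n].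

Lemma oneline_inj : injective oneline.
Proof.
move=> s t /eq_in_map est; apply/permP => i.
by apply/val_inj/est; rewrite mem_enum.
Qed.

Lemma oneline_permutations s : oneline s \in permutations (iota 0 n).
Proof.
rewrite mem_permutations -val_enum_ord /oneline (map_comp val s) perm_map //.
apply: uniq_perm; rewrite ?enum_uniq ?(map_inj_uniq perm_inj) ?enum_uniq //.
move=> i; rewrite mem_enum; apply/mapP; exists ((s^-1)%g i); rewrite ?mem_enum //.
by rewrite permKV.
Qed.

End OneLineNotation.

(* Structural recursions rather than bigops, so that they compute. *)
Fixpoint vandermonde_prod (l : seq nat) : int :=
  if l is x :: l' then
    foldr (fun y p => (y%:Z - x%:Z) * p) 1 l' * vandermonde_prod l'
  else 1.

Fixpoint shifted_powers (a : int) (l : seq nat) : int :=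
  if l is e :: l' then a ^+ e * shifted_powers (a + 1) l' else 1.

(** On [oneline s] this is the term of [s] in [PS S] at [a], times the factor
    [vandermonde_prod (iota 0 n)] common to all [s], so sums that vanish still vanish and no sign
    has to be computed. *)
Definition weight (a : int) (l : seq nat) : int :=
  vandermonde_prod l * shifted_powers a l.

Definition total_weight (a : int) (t : seq (seq nat)) : int :=
  foldr (fun l z => weight a l + z) 0 t.

Lemma vandermonde_prodE n (f : 'I_n -> nat) :
  vandermonde_prod [seq f i | i <- enum 'I_n] =
  \prod_(i < n) \prod_(j < n | (i < j)%N) ((f j)%:Z - (f i)%:Z).
Proof.
elim: n f => [|n IHn] f; first by rewrite enum_ord0 big_ord0.
rewrite enum_ordSl /= -map_comp big_ord_recl; congr (_ * _); last first.
  rewrite IHn; apply: eq_bigr => i _.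
  by rewrite [RHS]big_mkcond big_ord_recl /= mul1r -big_mkcond.
rewrite big_mkcond big_ord_recl /= mul1r.
(* Once the bigop is unlocked, both sides are right folds over the same mapped list, which [elim]
   generalizes. *)
by rewrite -big_enum /= -(big_map (f \o lift ord0) predT (fun y => y%:Z - (f ord0)%:Z))
  unlock; elim: map => //= y l ->.
Qed.

Lemma shifted_powersE n (f : 'I_n -> nat) (a : int) :
  shifted_powers a [seq f i | i <- enum 'I_n] =
  \prod_(i < n) (a + (val i)%:Z) ^+ f i.
Proof.
elim: n f a => [|n IHn] f a; first by rewrite enum_ord0 big_ord0.
rewrite enum_ordSl /= -map_comp big_ord_recl addr0 IHn; congr (_ * _).
by apply: eq_bigr => i _; rewrite /= -addrA.
Qed.

Lemma vandermonde_prod_oneline n (s : 'S_n) :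
  vandermonde_prod (oneline s) = (-1) ^+ s * vandermonde_prod (iota 0 n).
Proof.
rewrite -val_enum_ord /oneline !vandermonde_prodE.
pose a : 'rV[int]_n := \row_i (val i)%:Z.
pose b : 'rV[int]_n := \row_i (val (s i))%:Z.
have -> : \prod_(i < n) \prod_(j < n | (i < j)%N)
    ((val (s j))%:Z - (val (s i))%:Z) = \det (Vandermonde n b).
  rewrite det_Vandermonde.
  by apply: eq_bigr => i _; apply: eq_bigr => j _; rewrite !mxE.
have -> : \prod_(i < n) \prod_(j < n | (i < j)%N)
    ((val j)%:Z - (val i)%:Z) = \det (Vandermonde n a).
  rewrite det_Vandermonde.
  by apply: eq_bigr => i _; apply: eq_bigr => j _; rewrite !mxE.
have -> : Vandermonde n b = col_perm s (Vandermonde n a).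
  by apply/matrixP => i j; rewrite !mxE.
(* [col_permE] brings in the matrix of [s^-1], whose signature is that of [s]. *)
by rewrite col_permE det_mulmx det_perm odd_permV mulrC.
Qed.

Lemma total_weightE a t : total_weight a t = \sum_(l <- t) weight a l.
Proof. by elim: t => [|l t IHt]; rewrite ?big_nil // big_cons -IHt. Qed.

Lemma PS_horner_int n (S : {set 'S_n}) (a : int) :
  (PS S).[a%:~R] =
  (\sum_(s in S) (-1) ^+ s * shifted_powers a (oneline s))%:~R.
Proof.
rewrite /PS horner_sum rmorph_sum; apply: eq_bigr => s _.
rewrite hornerM rmorphM /= -signr_odd -[in RHS]signr_odd /oneline shifted_powersE.
congr (_ * _).
  by case: odd; rewrite /= ?expr0 ?expr1 ?hornerN ?hornerC ?rmorphN ?rmorph1.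
rewrite horner_prod rmorph_prod; apply: eq_bigr => i _.
by rewrite horner_exp hornerD hornerX hornerC rmorphXn /= rmorphD.
Qed.

Lemma total_weight_PS0 n (S : {set 'S_n}) (a : int) :
  PS S = 0 -> total_weight a [seq oneline s | s <- enum S] = 0.
Proof.
move=> PS0; have /eqP := PS_horner_int S a.
rewrite PS0 horner0 eq_sym intr_eq0 => /eqP sum0.
rewrite total_weightE big_map big_enum /=.
move/(congr1 ( *%R (vandermonde_prod (iota 0 n)))): sum0.
rewrite mulr0 mulr_sumr; apply: etrans; apply: eq_bigr => s _; rewrite /weight vandermonde_prod_oneline.
by rewrite mulrA [_ * (-1) ^+ s]mulrC.
Qed.

Section Subsequences.

Variable T : Type.
Implicit Types s : seq T.

Fixpoint subseqs s : seq (seq T) :=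
  if s is x :: s' then
    let r := subseqs s' in [seq x :: t | t <- r] ++ r
  else [:: [::]].

Fixpoint concatenations (cs : seq (seq (seq T))) : seq (seq T) :=
  if cs is c :: cs' then [seq t ++ u | t <- c, u <- concatenations cs']
  else [:: [::]].

End Subsequences.

Lemma filter_subseqs (T : eqType) (p : pred T) (s : seq T) :
  filter p s \in subseqs s.
Proof.
elim: s => //= x s IHs; rewrite mem_cat; case: (p x); last by rewrite IHs orbT.
by rewrite map_f.
Qed.

Lemma flatten_concatenations (T : eqType) (I : eqType) (r : seq I)
    (c : I -> seq (seq T)) (t : I -> seq T) :
  {in r, forall i, t i \in c i} ->
  flatten [seq t i | i <- r] \in concatenations [seq c i | i <- r].
Proof.
elim: r => //= i r IHr tc; apply: allpairs_f; first by rewrite tc ?mem_head.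
by apply: IHr => j jr; rewrite tc // inE jr orbT.
Qed.

Definition block n i := [seq l <- permutations (iota 0 n) | nth 0%N l i == 0%N].

(** Grouping by the position of the entry 0 makes a filter of the whole list the concatenation of
    the filters of the blocks. *)
Definition blocks n := flatten [seq block n i | i <- iota 0 n].

Definition null_subblocks n i :=
  [seq t <- subseqs (block n i) | total_weight (- i%:Z) t == 0].

(** Testing each block first keeps the search small: for n = 4 it examines 4 * 2^6 sublists instead
    of 2^24. *)
Definition null_candidates n :=
  concatenations [seq null_subblocks n i | i <- iota 0 n].

Definition blocks_partition n :=
  uniq (blocks n) && perm_eq (blocks n) (permutations (iota 0 n)).

(** At [- i] the factor in position i is a power of 0, which is 0 unless the exponent is 0, and then
    it is 1. *)
Definition blocks_separated n :=
  all (fun i => all (fun l =>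
    (l \in block n i) || (weight (- i%:Z) l == 0)) (blocks n)) (iota 0 n).

(** The bases are 1, ..., n at 1 and -n, ..., -1 at [- n]. None is 0, so these two points tie all
    the blocks together. *)
Definition only_nil_vanishes n :=
  all (fun t => [&& total_weight 1 t == 0 & total_weight (- n%:Z) t == 0]
    ==> nilp t) (null_candidates n).

Lemma small_blocks n : (1 <= n <= 4)%N ->
  [&& blocks_partition n, blocks_separated n & only_nil_vanishes n].
Proof. by case: n => [|[|[|[|[|n]]]]] // _; vm_compute. Qed.

Lemma filter_block n (p : pred (seq nat)) i :
  blocks_partition n ->
  perm_eq [seq l <- filter p (blocks n) | l \in block n i]
          (filter p (block n i)).
Proof.
move=> /andP[uB pB]; apply: uniq_perm; rewrite ?filter_uniq ?permutations_uniq //.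
move=> l; rewrite !mem_filter (perm_mem pB).
by case: (p l); case: (_ \in permutations _); rewrite ?andbF ?andbT.
Qed.

Lemma vanishing_filter_blocks n (p : pred (seq nat)) :
  (1 <= n <= 4)%N -> (forall a, total_weight a (filter p (blocks n)) = 0) ->
  filter p (blocks n) = [::].
Proof.
move=> /small_blocks /and3P[part /allP sep /allP only0] tot0.
apply/nilP/(implyP (only0 _ _)); last by rewrite !tot0 eqxx.
rewrite /blocks filter_flatten -map_comp.
apply: (flatten_concatenations (t := filter p \o block n)) => i i_n.
(* The right-hand 0 becomes the sum at [- i] over the whole selection. It exceeds the sum over block
   i only by terms of other blocks, which are 0 at [- i]. *)
rewrite mem_filter filter_subseqs andbT -(tot0 (- i%:Z)) !total_weightE /=.
rewrite -(perm_big _ (filter_block p i part)) big_filter /= big_mkcond /=.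
apply/eqP; rewrite !big_seq; apply: eq_bigr => l; rewrite mem_filter => /andP[_ lB].
have /allP/(_ l lB) := sep i i_n.
by case: ifP => //= _ /eqP.
Qed.

Theorem theorem2p10 (n : nat) (hn : (1 <= n <= 4)%N) (S : {set 'S_n}) :
  S != set0 -> PS S != 0.
Proof.
apply: contra_neq => PS0.
set L := [seq oneline s | s <- enum S].
have /and3P[/andP[uB pB] _ _] := small_blocks hn.
have subL l : l \in L -> l \in blocks n.
  by case/mapP => s _ ->; rewrite (perm_mem pB) oneline_permutations.
(* The candidates follow the order of [blocks n], so [L] is traded for the filter of that list with
   the same entries. *)
have pL : perm_eq [seq l <- blocks n | l \in L] L.
  apply: uniq_perm; rewrite ?filter_uniq ?(map_inj_uniq (@oneline_inj n)) ?enum_uniq //.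
  by move=> l; rewrite mem_filter andb_idr //; apply: subL.
have L0 : [seq l <- blocks n | l \in L] = [::].
  apply: vanishing_filter_blocks hn _ => a.
  by rewrite total_weightE (perm_big _ pL) -total_weightE total_weight_PS0.
apply/setP => s; rewrite inE; apply/negP => sS.
have: oneline s \in [::] by rewrite -L0 (perm_mem pL) map_f ?mem_enum.
by [].
Qed.
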